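(* Let $n\ge3$ and let the eigenspaces of the cycle graph $C_n$ be in frequency order (with ties broken arbitrarily). Then the minimum cardinality of an arbitrarily weighted extremal design in $C_n$ is achieved by positively weighted extremal designs.
   Context: $C_n$ is the cycle graph on $n$ vertices. For a connected $\delta$-regular graph $G$ on $n$ vertices with adjacency matrix $A$, eigenvalues and eigenspaces mean those of $\frac1\delta A$. Frequency order means that eigenspaces $\Lambda_1<\cdots<\Lambda_m$ are ordered by decreasing absolute value of the eigenvalue, with $\Lambda_1=\operatorname{span}\{\mathbb{1}\}$ (eigenvalue $1$) first. A vertex subset $W$ with real weights $(a_w)_{w\in W}$ averages an eigenspace $\Lambda$ if $\sum_{w\in W}a_w\phi(w)=\frac1n\sum_{v}\phi(v)$ for all $\phi\in\Lambda$. $W$ is an (arbitrarily) weighted extremal design if there are weights $a_w\in\mathbb{R}$ with which $W$ averages all eigenspaces except the last one; it is a positively weighted extremal design if this is possible with all $a_w>0$. *)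

(* Defs.v *)
From mathcomp Require Import all_boot all_order all_algebra.
From mathcomp Require Import reals.
Set Implicit Arguments.
Unset Strict Implicit.
Unset Printing Implicit Defensive.
Import Order.TTheory GRing.Theory Num.Theory.
Local Open Scope ring_scope.

(* For n <= 2 this relation is not a simple 2-regular graph: it is a loop for
   n = 1 and a single edge for n = 2. *)
Definition cycle_graph (n : nat) : rel 'I_n :=
  fun i j => (j == ordS i) || (i == ordS j).

Definition adjacency (R : realType) (n : nat) (e : rel 'I_n) : 'M[R]_n :=
  \matrix_(i, j) (e i j)%:R.

(* The matrix (1/d) A of a d-regular graph. *)
Definition norm_adjacency (R : realType) (n : nat) (d : nat) (e : rel 'I_n) :
    'M[R]_n :=
  d%:R^-1 *: adjacency R e.

(* A function phi on the vertices is a row vector.  [eigenspace M a] consists of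
   the row vectors phi with phi *m M = a *: phi; for the symmetric matrices used
   here this is the usual (column) eigenspace. *)

(* An ordering of the eigenspaces is given by the sequence s of the (pairwise
   distinct) eigenvalues: the i-th eigenspace is [eigenspace M s`_i].  The
   ordering among eigenvalues of equal absolute value is left free, except that
   the eigenvalue 1 comes first (the eigenvalue -1 of a bipartite graph ties
   with it). *)
Definition frequency_order (R : realType) (n : nat) (M : 'M[R]_n) (s : seq R) :
    Prop :=
  [/\ uniq s,
      forall a : R, (a \in s) = eigenvalue M a,
      ohead s = Some 1
    & sorted (fun a b : R => `|b| <= `|a|) s].

(* Only the values of the weight function a on W matter. *)
Definition averages (R : realType) (n : nat) (W : {set 'I_n}) (a : 'I_n -> R)
    (L : 'M[R]_n) : Prop :=
  forall phi : 'rV[R]_n, (phi <= L)%MS ->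
    \sum_(w in W) a w * phi 0 w = n%:R^-1 * \sum_(v < n) phi 0 v.

Definition averages_all_but_last (R : realType) (n : nat) (M : 'M[R]_n)
    (s : seq R) (W : {set 'I_n}) (a : 'I_n -> R) : Prop :=
  forall i : nat, (i < (size s).-1)%N -> averages W a (eigenspace M s`_i).

Definition weighted_extremal_design (R : realType) (n : nat) (M : 'M[R]_n)
    (s : seq R) (W : {set 'I_n}) : Prop :=
  exists a : 'I_n -> R, averages_all_but_last M s W a.

Definition positively_weighted_extremal_design (R : realType) (n : nat)
    (M : 'M[R]_n) (s : seq R) (W : {set 'I_n}) : Prop :=
  exists a : 'I_n -> R,
    (forall w, w \in W -> 0 < a w) /\ averages_all_but_last M s W a.

(* The factor 1/2 in the normalized adjacency matrix of a cycle. *)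
Lemma cycle_graph_regular (n : nat) (i : 'I_n) :
  (3 <= n)%N -> #|[set j | cycle_graph i j]| = 2%N.
Proof.
move=> n3.
have -> : [set j | cycle_graph i j] = [set ordS i; ord_pred i].
  apply/setP=> j; rewrite !inE /cycle_graph; congr (_ || _).
  apply/eqP/eqP => ->; by rewrite ?ordSK ?ord_predK.
rewrite cards2; suff -> : ordS i != ord_pred i by [].
apply/eqP => /(congr1 (@ordS n)); rewrite ord_predK => /(congr1 val) /=.
rewrite -[(_ %% n).+1]addn1 modnDml addn1 => H.
have : (i + 2 == i + 0 %[mod n])%N by rewrite addn2 H addn0 modn_small.
by rewrite eqn_modDl mod0n modn_small.
Qed.

(* Main.v *)
Require Import Defs.
From mathcomp Require Import all_boot all_order all_algebra.
From mathcomp Require Import reals trigo.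
From mathcomp Require Import ring lra.
Import Order.TTheory GRing.Theory Num.Theory.
Local Open Scope ring_scope.

(** Let [M] be the normalized adjacency matrix of the cycle on [n] vertices, let
[lam] be its last eigenvalue in frequency order, and view the vertices as the
group Z/n.  Weights [a] on [W], extended by zero, average every eigenspace but
the last exactly when their deviation [a - 1/n] from the uniform weights is
orthogonal to all the other eigenspaces.  Since the cosine waves form a
complete system of eigenvectors, this says that the deviation belongs to the
eigenspace of [lam] ([averages_all_but_lastP]).  So a set is a design exactly
when it contains the support of some function [1/n + phi] with [phi] in the last
eigenspace, and the smallest designs come from the functions of this form with
as many zeros as possible.

The absolute value of [lam] is less than [1], because it is the smallest one and
that of the eigenvalue [cos (2 pi / n)] is less than [1]
([last_eigenvalue_lt1]).  Then [lam = cos theta] with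
[theta = 2 pi k / n], and the last eigenspace consists of the waves
[A cos (theta w) + B sin (theta w)] ([eigen_wave]).  Up to scaling, the weight
at [w] is therefore the value of an affine function of the plane at the point
[(cos (theta w), sin (theta w))] of the unit circle.  The map from [w] to this
point is a group morphism, with a kernel of some order [g], so that each point
of its image is the image of exactly [g] vertices.  A line meets the circle in
at most two points, hence at most [2 g] weights vanish ([card_zeros_le]).

This bound is attained by nonnegative weights ([tight_chord]): take the line
through [(1, 0)] and a point of the image with the largest abscissa [c] among
the other ones.  The points of the circle with abscissa at most [c] all lie on
one side of that line, so no weight is negative, and [2 g] of them are zero. *)

(** * Waves on the cyclic group *)

Definition ccos (R : realType) (m : nat) (k w : 'I_m.+3) : R :=
  cos ((pi *+ 2 / m.+3%:R) *+ (k * w)).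

Definition csin (R : realType) (m : nat) (k w : 'I_m.+3) : R :=
  sin ((pi *+ 2 / m.+3%:R) *+ (k * w)).

(** This periodicity is what makes [ccos] and [csin] functions on the group
['I_m.+3], whose addition is reduced modulo [m.+3]. *)
Lemma cos_sin_mod (R : realType) (m j : nat) :
  let x : R := pi *+ 2 / m.+3%:R in
  cos (x *+ (j %% m.+3)) = cos (x *+ j) /\
  sin (x *+ (j %% m.+3)) = sin (x *+ j).
Proof.
move=> x; have xn : x *+ m.+3 = pi *+ 2.
  by rewrite /x -[_ *+ m.+3]mulr_natr divfK // pnatr_eq0.
have -> : x *+ j = x *+ (j %% m.+3) + (pi *+ 2) *+ (j %/ m.+3).
  by rewrite -xn -mulrnA -mulrnDr {1}(divn_eq j m.+3) addnC mulnC.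
by rewrite (periodicn (@cosD2pi R)) (periodicn (@sinD2pi R)).
Qed.

Lemma ccosC (R : realType) (m : nat) (k w : 'I_m.+3) :
  ccos R m k w = ccos R m w k.
Proof. by rewrite /ccos mulnC. Qed.

Lemma ccosD (R : realType) (m : nat) (k v w : 'I_m.+3) :
  ccos R m k (v + w) =
  ccos R m k v * ccos R m k w - csin R m k v * csin R m k w.
Proof.
rewrite /ccos /csin -cosD -mulrnDr -mulnDr /=.
rewrite -(proj1 (cos_sin_mod _ _ (k * (v + w)))) -modnMmr.
by rewrite (proj1 (cos_sin_mod _ _ _)).
Qed.

Lemma csinD (R : realType) (m : nat) (k v w : 'I_m.+3) :
  csin R m k (v + w) =
  csin R m k v * ccos R m k w + ccos R m k v * csin R m k w.
Proof.
rewrite /ccos /csin -sinD -mulrnDr -mulnDr /=.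
rewrite -(proj2 (cos_sin_mod _ _ (k * (v + w)))) -modnMmr.
by rewrite (proj2 (cos_sin_mod _ _ _)).
Qed.

Lemma ccos0 (R : realType) (m : nat) (k : 'I_m.+3) : ccos R m k 0 = 1.
Proof. by rewrite /ccos muln0 cos0. Qed.

Lemma csin0 (R : realType) (m : nat) (k : 'I_m.+3) : csin R m k 0 = 0.
Proof. by rewrite /csin muln0 sin0. Qed.

Lemma ccos2Dcsin2 (R : realType) (m : nat) (k w : 'I_m.+3) :
  ccos R m k w ^+ 2 + csin R m k w ^+ 2 = 1.
Proof. exact: cos2Dsin2. Qed.

(** The negation in ['I_m.+3] is not that of the angle, so the parity of the
cosine does not apply; the equations [ccos 0 = 1] and [csin 0 = 0], expanded by
the addition formulas at [w + (- w)], are solved for the values at [- w]. *)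
Lemma ccosN (R : realType) (m : nat) (k w : 'I_m.+3) :
  ccos R m k (- w) = ccos R m k w.
Proof.
have := ccosD R m k w (- w); have := csinD R m k w (- w).
rewrite subrr ccos0 csin0 => es ec.
have c2 := ccos2Dcsin2 R m k w.
have -> : ccos R m k (- w) = ccos R m k (- w) *
   (ccos R m k w ^+ 2 + csin R m k w ^+ 2) by rewrite c2 mulr1.
transitivity (ccos R m k w * (ccos R m k w * ccos R m k (- w)
                              - csin R m k w * csin R m k (- w))
              + csin R m k w * (csin R m k w * ccos R m k (- w)
                                + ccos R m k w * csin R m k (- w))).
  by ring.
by rewrite -es -ec; ring.
Qed.

Lemma csinN (R : realType) (m : nat) (k w : 'I_m.+3) :
  csin R m k (- w) = - csin R m k w.
Proof.
have := ccosD R m k w (- w); have := csinD R m k w (- w).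
rewrite subrr ccos0 csin0 ccosN => es ec.
have c2 := ccos2Dcsin2 R m k w.
have -> : csin R m k (- w) = csin R m k (- w) *
   (ccos R m k w ^+ 2 + csin R m k w ^+ 2) by rewrite c2 mulr1.
transitivity (ccos R m k w * (csin R m k w * ccos R m k w
                              + ccos R m k w * csin R m k (- w))
              - csin R m k w * (ccos R m k w * ccos R m k w
                                - csin R m k w * csin R m k (- w))).
  by ring.
by rewrite -es -ec; ring.
Qed.

(** For [d != 0], translating the summation index by [1] rotates the vector
[(T, U)] of the cosine and sine sums by the angle [2 pi d / n] without changing
it; this rotation is not the identity, so the vector is zero. *)
Lemma sum_ccos (R : realType) (m : nat) (d : 'I_m.+3) :
  \sum_k ccos R m k d = m.+3%:R *+ (d == 0).
Proof.
have [->|d0] := eqVneq d 0.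
  under eq_bigr do rewrite ccos0.
  by rewrite sumr_const card_ord.
under eq_bigr do rewrite ccosC.
set c := ccos R m d 1; set s := csin R m d 1.
set T := \sum_k _; pose U := \sum_k csin R m d k.
have eT : T = T * c - U * s.
  rewrite {1}/T (reindex_inj (addIr (1 : 'I_m.+3))) /=.
  under eq_bigr do rewrite ccosD.
  by rewrite sumrB -!mulr_suml.
have eU : U = U * c + T * s.
  rewrite {1}/U (reindex_inj (addIr (1 : 'I_m.+3))) /=.
  under eq_bigr do rewrite csinD.
  by rewrite big_split /= -!mulr_suml.
have c2 : c ^+ 2 + s ^+ 2 = 1 := ccos2Dcsin2 R m d 1.
have c1 : c < 1.
  rewrite /c /ccos muln1 mulrnAl -mulrnA mulnC mulrnA cos_mulr2n.
  set x := _ *+ d.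
  (* [c] has become [1 - 2 sin^2 x], where [x = pi d / n] lies in [(0, pi)]. *)
  have : 0 < sin x.
    apply: sin_gt0_pi; rewrite /x -[_ *+ d]mulr_natr -mulrA [_^-1 * _]mulrC.
    have dgt : (0 < d)%N by rewrite lt0n.
    rewrite mulr_gt0 ?pi_gt0 ?divr_gt0 ?ltr0n //=.
    by rewrite gtr_pMr ?pi_gt0 // ltr_pdivrMr ?ltr0n // mul1r ltr_nat.
  have := cos2Dsin2 x; nra.
have : T * (1 - c) = 0.
  (* Eliminating [U] gives [T (1 - c)^2 = - T s^2], and [s^2] is
     [(1 - c) (1 + c)]. *)
  have e2 : U * (1 - c) = T * s by lra.
  have e3 : T * (1 - c) = - U * s by lra.
  have e4 : T * (1 - c) * (1 - c) = - T * s ^+ 2.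
    by rewrite e3 mulrAC mulNr e2; ring.
  have e5 : T * (1 - c) * (1 + c) = T * s ^+ 2.
    by rewrite -mulrA -subr_sqr expr1n -c2; ring.
  lra.
by move/eqP; rewrite mulf_eq0 subr_eq0 (gt_eqF c1) orbF => /eqP.
Qed.

(** * The spectrum of the cycle *)

Lemma mulmx_cycle (R : realType) (m p : nat) (A : 'M[R]_(p, m.+3)) i v :
  (A *m norm_adjacency R 2 (@cycle_graph m.+3)) i v
  = (A i (v - 1) + A i (v + 1)) / 2.
Proof.
have ordSE (w : 'I_m.+3) : ordS w = w + 1.
  by apply: val_inj => /=; rewrite -addn1.
(* The two neighbours are distinct because [2 != 0] in ['I_m.+3]. *)
have nbr : v + 1 != v - 1.
  apply/eqP => /(congr1 (fun x => x + 1 - v)); rewrite subrK subrr.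
  by rewrite addrAC [v + 1]addrC addrK => /(congr1 val).
rewrite mxE (bigD1 (v - 1)) //= (bigD1 (v + 1)) //= big1 => [|j /andP[j1 j2]].
  rewrite !mxE /cycle_graph !ordSE subrK !eqxx orbT /=; lra.
rewrite !mxE /cycle_graph !ordSE (negPf j2).
by rewrite -subr_eq eq_sym (negPf j1) !mulr0.
Qed.

Lemma cycle_sym (R : realType) (n : nat) :
  (norm_adjacency R 2 (@cycle_graph n))^T = norm_adjacency R 2 (@cycle_graph n).
Proof. by apply/matrixP => i j; rewrite !mxE /cycle_graph orbC. Qed.

Lemma wave_eigen (R : realType) (m : nat) (k : 'I_m.+3) (A B : R)
    (phi : 'rV[R]_m.+3) :
  (forall w, phi 0 w = A * ccos R m k w + B * csin R m k w) ->
  phi *m norm_adjacency R 2 (@cycle_graph m.+3) = ccos R m k 1 *: phi.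
Proof.
move=> e; apply/rowP => v; rewrite mulmx_cycle mxE !e !ccosD !csinD ccosN csinN.
by field.
Qed.

(** The real part of the convolution with the character of frequency [k].  The
sum of these matrices over all [k] is the Fourier inversion formula
([sum_wave_mx]), which makes them a resolution of the identity into
eigenvectors. *)
Definition wave_mx (R : realType) (m : nat) (k : 'I_m.+3) : 'M[R]_m.+3 :=
  \matrix_(v, w) ccos R m k (v - w).

Lemma wave_mx_eigen (R : realType) (m : nat) (k : 'I_m.+3) :
  wave_mx R m k *m norm_adjacency R 2 (@cycle_graph m.+3)
  = ccos R m k 1 *: wave_mx R m k.
Proof.
apply/row_matrixP => v; rewrite row_mul [RHS]linearZ /=.
apply: (@wave_eigen _ _ _ (ccos R m k v) (csin R m k v)) => w.
by rewrite !mxE ccosD ccosN csinN; ring.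
Qed.

Lemma wave_mx_sym (R : realType) (m : nat) (k : 'I_m.+3) :
  (wave_mx R m k)^T = wave_mx R m k.
Proof. by apply/matrixP => v w; rewrite !mxE -ccosN opprB. Qed.

Lemma sum_wave_mx (R : realType) (m : nat) :
  \sum_k wave_mx R m k = m.+3%:R%:M.
Proof.
apply/matrixP => v w; rewrite summxE !mxE -subr_eq0 -sum_ccos.
by apply: eq_bigr => k _; rewrite mxE.
Qed.

Lemma wave_expansion (R : realType) (m p : nat) (A : 'M[R]_(p, m.+3)) :
  m.+3%:R *: A = \sum_k A *m wave_mx R m k.
Proof. by rewrite -mulmx_sumr sum_wave_mx mul_mx_scalar. Qed.

Lemma eigenvalue_ccos (R : realType) (m : nat) (k : 'I_m.+3) :
  eigenvalue (norm_adjacency R 2 (@cycle_graph m.+3)) (ccos R m k 1).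
Proof.
apply/eigenvalueP; exists (row 0 (wave_mx R m k)).
  by rewrite -row_mul wave_mx_eigen linearZ.
apply/eqP => /rowP/(_ 0); rewrite !mxE subrr ccos0 => /eqP.
by rewrite oner_eq0.
Qed.

(** The matrices [wave_mx k] commute with [M], so an eigenvector whose
eigenvalue is none of the [ccos k 1] is annihilated by each of them, hence by
their sum, a nonzero scalar matrix. *)
Lemma eigenvalue_cycle (R : realType) (m : nat) (lam : R) :
  eigenvalue (norm_adjacency R 2 (@cycle_graph m.+3)) lam ->
  exists k, lam = ccos R m k 1.
Proof.
set M := norm_adjacency _ _ _.
case/eigenvalueP => phi ephi phi0.
have [k /eqP|none] := pickP (fun k => lam == ccos R m k 1); first by exists k.
suff : m.+3%:R *: phi = 0.
  by move/eqP; rewrite scaler_eq0 pnatr_eq0 (negPf phi0).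
rewrite wave_expansion big1 // => k _.
have eMW : M *m wave_mx R m k = ccos R m k 1 *: wave_mx R m k.
  apply: trmx_inj; rewrite trmx_mul cycle_sym wave_mx_sym wave_mx_eigen.
  by rewrite linearZ /= wave_mx_sym.
have : (lam - ccos R m k 1) *: (phi *m wave_mx R m k) = 0.
  by rewrite scalerBl scalemxAl -ephi -mulmxA eMW -scalemxAr subrr.
by move/eqP; rewrite scaler_eq0 subr_eq0 none => /eqP.
Qed.

Lemma eigenspace_orthogonal (F : fieldType) (n : nat) (M : 'M[F]_n)
    (phi psi : 'rV[F]_n) (a b : F) :
  M^T = M -> phi *m M = a *: phi -> psi *m M = b *: psi -> a != b ->
  phi *m psi^T = 0.
Proof.
move=> Msym ephi epsi ab.
have : (a - b) *: (phi *m psi^T) = 0.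
  rewrite scalerBl scalemxAl -ephi scalemxAr -linearZ /= -epsi trmx_mul Msym.
  by rewrite mulmxA subrr.
by move/eqP; rewrite scaler_eq0 subr_eq0 (negPf ab) => /eqP.
Qed.

(** The converse of [eigenspace_orthogonal], where completeness of the waves is
used: in the expansion of [b], the components of frequency [k] with
[ccos k 1 != lam] vanish, and [M] multiplies each remaining one by [lam]. *)
Lemma orthogonal_others_eigen (R : realType) (m : nat) (lam : R)
    (b : 'rV[R]_m.+3) :
  (forall k, ccos R m k 1 != lam -> forall phi : 'rV_m.+3,
     phi *m norm_adjacency R 2 (@cycle_graph m.+3) = ccos R m k 1 *: phi ->
     b *m phi^T = 0) ->
  b *m norm_adjacency R 2 (@cycle_graph m.+3) = lam *: b.
Proof.
move=> orth; have nz : m.+3%:R != 0 :> R by rewrite pnatr_eq0.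
apply: (scalerI nz); rewrite scalemxAl scalerA mulrC -scalerA wave_expansion.
rewrite mulmx_suml scaler_sumr; apply: eq_bigr => k _.
rewrite -mulmxA wave_mx_eigen -scalemxAr.
have [->//|kl] := eqVneq (ccos R m k 1) lam.
suff -> : b *m wave_mx R m k = 0 by rewrite !scaler0.
apply: trmx_inj; rewrite trmx_mul wave_mx_sym trmx0.
apply/row_matrixP => v; rewrite row_mul row0; apply: trmx_inj.
rewrite trmx_mul trmxK trmx0; apply: orth kl _ _.
by rewrite -row_mul wave_mx_eigen linearZ.
Qed.

(** An eigenvector satisfies a linear recurrence of order two, so it is
determined by its values at [0] and [1].  A wave of frequency [k] can be fitted
to these two values because the sine does not vanish at [1]. *)
Lemma eigen_wave (R : realType) (m : nat) (k : 'I_m.+3) (phi : 'rV[R]_m.+3) :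
  `|ccos R m k 1| < 1 ->
  phi *m norm_adjacency R 2 (@cycle_graph m.+3) = ccos R m k 1 *: phi ->
  exists A B, forall w, phi 0 w = A * ccos R m k w + B * csin R m k w.
Proof.
move=> lt1 ephi; set M := norm_adjacency _ _ _ in ephi.
have s0 : csin R m k 1 != 0.
  apply/eqP => s0; move: lt1; have := ccos2Dcsin2 R m k 1.
  by rewrite s0 expr0n addr0 => /eqP; rewrite sqrf_eq1 => /pred2P[]->;
     rewrite ?normrN normr1 ltxx.
pose A := phi 0 0; pose B := (phi 0 1 - A * ccos R m k 1) / csin R m k 1.
exists A, B.
pose g := \row_w (A * ccos R m k w + B * csin R m k w).
pose h := phi - g.
have eh : h *m M = ccos R m k 1 *: h.
  rewrite mulmxBl ephi scalerBr; congr (_ - _).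
  by apply: wave_eigen => w; rewrite mxE.
have nS j : j.+1%:R = j%:R + 1 :> 'I_m.+3 by rewrite natr1.
have h0 (i : nat) : h 0 i%:R = 0 /\ h 0 i.+1%:R = 0.
  elim: i => [|i [hi hi1]].
    by rewrite !mxE ccos0 csin0 -/A /B; split; field.
  split=> //; have /rowP/(_ i.+1%:R) := eh.
  by rewrite mulmx_cycle [RHS]mxE hi1 !nS addrK hi; lra.
move=> w; have [+ _] := h0 w; rewrite natr_Zp !mxE => /eqP.
by rewrite subr_eq0 => /eqP.
Qed.

(** * Zeros of affine functions along the circle *)

(** The kernel of the morphism from the vertices to the unit circle. *)
Definition circle_ker (R : realType) (m : nat) (k : 'I_m.+3) : {set 'I_m.+3} :=
  [set w | ccos R m k w == 1].

Lemma csin_circle_ker (R : realType) (m : nat) (k w : 'I_m.+3) :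
  ccos R m k w = 1 -> csin R m k w = 0.
Proof.
move=> c1; have := ccos2Dcsin2 R m k w; rewrite c1 expr1n => /eqP.
by rewrite -subr_eq0 addrAC subrr add0r sqrf_eq0 => /eqP.
Qed.

(** For [u] in a fibre, the translation [w |-> w - u] embeds it into the kernel. *)
Lemma card_fiber_le (R : realType) (m : nat) (k : 'I_m.+3) (X : {set 'I_m.+3}) :
  {in X &, forall u v,
     ccos R m k u = ccos R m k v /\ csin R m k u = csin R m k v} ->
  (#|X| <= #|circle_ker R m k|)%N.
Proof.
move=> same; have [->|[u uX]] := set_0Vmem X; first by rewrite cards0.
rewrite -(card_imset _ (addIr (- u))); apply/subset_leq_card/subsetP.
move=> _ /imsetP[v vX ->]; have [ec es] := same _ _ vX uX.
by rewrite inE ccosD ccosN csinN ec es mulrN opprK -!expr2 ccos2Dcsin2.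
Qed.

(** On the line [1 + A x + B y = 0] a point is determined by its coordinate
[z = A y - B x] along the line, and on the circle [z] has a prescribed square.
So the zeros are split according to the two possible signs of [z], and each part
lies in a single fibre. *)
Lemma card_zeros_le (R : realType) (m : nat) (k : 'I_m.+3) (A B : R) :
  (#|[set w | (1 + (A * ccos R m k w + B * csin R m k w) == 0)%R]|
     <= 2 * #|circle_ker R m k|)%N.
Proof.
set Z := [set w | _]; pose z w := A * csin R m k w - B * ccos R m k w.
have zE w : w \in Z ->
  [/\ z w ^+ 2 = A ^+ 2 + B ^+ 2 - 1,
      (A ^+ 2 + B ^+ 2) * ccos R m k w = - A - B * z w
    & (A ^+ 2 + B ^+ 2) * csin R m k w = - B + A * z w].
  rewrite inE addr_eq0 => /eqP e; have c2 := ccos2Dcsin2 R m k w; split.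
  - have -> : z w ^+ 2 = (A ^+ 2 + B ^+ 2) *
      (ccos R m k w ^+ 2 + csin R m k w ^+ 2)
      - (A * ccos R m k w + B * csin R m k w) ^+ 2 by rewrite /z; ring.
    by rewrite c2 mulr1 -[X in _ - X]sqrrN -e expr1n.
  - have -> : - A = A * (A * ccos R m k w + B * csin R m k w).
      by rewrite -[A * _ + _]opprK -e mulrN1.
    by rewrite /z; ring.
  - have -> : - B = B * (A * ccos R m k w + B * csin R m k w).
      by rewrite -[A * _ + _]opprK -e mulrN1.
    by rewrite /z; ring.
have same (X : {set 'I_m.+3}) : X \subset Z ->
    {in X &, forall u v, z u = z v} -> (#|X| <= #|circle_ker R m k|)%N.
  move=> /subsetP XZ ez; apply: card_fiber_le => u v uX vX.
  have [zu cu su] := zE u (XZ _ uX); have [_ cv sv] := zE v (XZ _ vX).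
  (* [A = B = 0] would make the line empty: it would force [z ^+ 2 = -1]. *)
  have D0 : A ^+ 2 + B ^+ 2 != 0.
    by apply/eqP => D0; have := sqr_ge0 (z u); rewrite zu D0; lra.
  by split; apply: (mulfI D0); rewrite ?cu ?cv ?su ?sv (ez u v).
have [->|[u uZ]] := set_0Vmem Z; first by rewrite cards0.
rewrite -(cardsID [set w | z w == z u] Z) mul2n -addnn leq_add //.
  apply: same => [|v w]; first exact: subsetIl.
  by rewrite !inE => /andP[_ /eqP->] /andP[_ /eqP->].
apply: same => [|v w]; first exact: subsetDl.
have zN v' : v' \in Z :\: [set w | z w == z u] -> z v' = - z u.
  rewrite inE inE => /andP[ne vZ]; have [zv _ _] := zE _ vZ.
  have [zu _ _] := zE _ uZ; move/eqP: zv; rewrite -zu eqf_sqr (negPf ne).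
  by move/eqP.
by move=> /zN -> /zN ->.
Qed.

(** The chord joins [(1, 0)] to [(c, s)], where [c] is the largest cosine other
than [1]; the slope [t] is chosen to make the affine function vanish at both
points.  For another point [(x, y)] of the circle, with [x <= c], the inequality
[(t y)^2 <= (1 - x)^2] reduces to [0 <= 2 (1 - x) (c - x)].  The zeros then
include the kernel and its translate by [p]. *)
Lemma tight_chord (R : realType) (m : nat) (k : 'I_m.+3) :
  `|ccos R m k 1| < 1 ->
  exists t : R,
    (forall w, 0 <= 1 - ccos R m k w - t * csin R m k w) /\
    (2 * #|circle_ker R m k| <=
       #|[set w | (1 - ccos R m k w - t * csin R m k w == 0)%R]|)%N.
Proof.
rewrite ltr_norml => /andP[gtN1 lt1].
case: (@arg_maxP _ R _ (1 : 'I_m.+3) (fun w => ccos R m k w != 1) (ccos R m k)).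
  by rewrite lt_eqF.
move=> p c1 pmax; set c := ccos R m k p in c1 pmax.
have c_gtN1 : -1 < c by apply: lt_le_trans gtN1 (pmax _ _); rewrite lt_eqF.
have c_lt1 : c < 1 by rewrite lt_neqAle c1 cos_le1.
(* [c > -1] ensures that [(c, s)] is not on the horizontal axis. *)
have e := ccos2Dcsin2 R m k p; rewrite -/c in e.
set s := csin R m k p in e.
have s0 : s != 0 by apply/eqP => s0; move: e; rewrite s0; nra.
pose t := (1 - c) / s; exists t.
have tt : t * s = 1 - c by rewrite divfK.
have t2 : t ^+ 2 * (1 + c) = 1 - c.
  apply: (mulfI (_ : 1 - c != 0)); first by rewrite subr_eq0 eq_sym.
  rewrite mulrCA -subr_sqr expr1n -[X in X - _ ^+ 2]e addrAC subrr add0r.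
  by rewrite -exprMn tt expr2.
split=> [w|].
  set x := ccos R m k w; set y := csin R m k w.
  have exy : x ^+ 2 + y ^+ 2 = 1 := ccos2Dcsin2 R m k w.
  have [x1|x1] := eqVneq x 1.
    by rewrite /y (csin_circle_ker _ _ _ _ x1) x1 mulr0 subrr subr0.
  have xc : x <= c by exact: pmax.
  rewrite subr_ge0; apply: le_trans (ler_norm _) _.
  rewrite -ler_sqr ?nnegrE ?normr_ge0 ?real_normK ?num_real //; last by lra.
  rewrite -(ler_pM2r (_ : 0 < 1 + c)); last by lra.
  rewrite exprMn mulrAC t2 -subr_ge0.
  have -> : y ^+ 2 = 1 - x ^+ 2 by rewrite -exy; ring.
  have -> : (1 - x) ^+ 2 * (1 + c) - (1 - c) * (1 - x ^+ 2)
     = 2 * (1 - x) * (c - x) by ring.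
  by rewrite mulr_ge0 //; lra.
pose P := [set w + p | w in circle_ker R m k].
have disj : [disjoint circle_ker R m k & P].
  rewrite disjoint_subset; apply/subsetP => w; rewrite !inE => /eqP w1.
  apply/negP => /imsetP[v]; rewrite inE => /eqP v1 ew.
  move: w1; rewrite ew ccosD v1 (csin_circle_ker _ _ _ _ v1) mul1r mul0r subr0.
  by move/eqP; rewrite (negPf c1).
have cP : #|P| = #|circle_ker R m k| by rewrite card_imset //; apply: addIr.
have /eqP cU : #|circle_ker R m k :|: P| == (#|circle_ker R m k| + #|P|)%N.
  by rewrite (leq_card_setU _ _).2.
rewrite mul2n -addnn -{2}cP -cU.
apply/subset_leq_card/subsetP => w; rewrite !inE => /orP[/eqP w1|].
  by rewrite w1 (csin_circle_ker _ _ _ _ w1) mulr0 subrr subr0.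
case/imsetP => v; rewrite inE => /eqP v1 ->.
rewrite ccosD csinD v1 (csin_circle_ker _ _ _ _ v1) -/c -/s.
by rewrite !mul1r !mul0r add0r subr0 tt subrr.
Qed.

(** * Designs and the last eigenspace *)

Definition deviation (R : realType) (n : nat) (W : {set 'I_n}) (a : 'I_n -> R) :
    'rV[R]_n :=
  \row_w ((if w \in W then a w else 0) - n%:R^-1).

Lemma averagesP (R : realType) (n : nat) (W : {set 'I_n}) (a : 'I_n -> R)
    (L : 'M[R]_n) :
  averages W a L <->
  (forall phi : 'rV[R]_n, (phi <= L)%MS -> deviation R n W a *m phi^T = 0).
Proof.
have dE (phi : 'rV[R]_n) : (deviation R n W a *m phi^T) 0 0
  = \sum_(w in W) a w * phi 0 w - n%:R^-1 * \sum_(v < n) phi 0 v.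
  rewrite mxE mulr_sumr [X in _ = X - _]big_mkcond -sumrB; apply: eq_bigr => w _.
  by rewrite !mxE; case: ifP => _; ring.
split=> avg phi /avg.
  by move=> e; apply/matrixP => i j; rewrite !ord1 dE e subrr mxE.
by move/matrixP/(_ 0 0); rewrite dE mxE => /eqP; rewrite subr_eq0 => /eqP.
Qed.

(** The last eigenvalue has the smallest absolute value, and the eigenvalue
[cos (2 pi / n)] already lies strictly between [-1] and [1]. *)
Lemma last_eigenvalue_lt1 (R : realType) (m : nat) (s : seq R) :
  frequency_order (norm_adjacency R 2 (@cycle_graph m.+3)) s ->
  `|last 1 s| < 1.
Proof.
case=> _ mem_s _ srt.
have c_s : ccos R m 1 1 \in s by rewrite mem_s eigenvalue_ccos.
have : `|ccos R m 1 1| < 1.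
  rewrite lt_neqAle cos_max andbT norm_cos_eq1 muln1 gt_eqF //.
  have pi0 := pi_gt0 R; apply: sin_gt0_pi; apply/andP; split.
    by rewrite divr_gt0 ?ltr0n // mulr2n addr_gt0.
  by rewrite ltr_pdivrMr ?ltr0n // -[pi *+ 2]mulr_natr ltr_pM2l // ltr_nat.
apply: le_lt_trans; rewrite -nth_last -(nth_index 1 c_s).
have lts : (index (ccos R m 1%R 1%R) s < size s)%N by rewrite index_mem.
apply: (sorted_leq_nth _ _ 1 srt); rewrite ?inE //.
- by move=> x y z yx zy; apply: le_trans zy yx.
- by rewrite -(ltn_predK lts).
- by rewrite -ltnS (ltn_predK lts).
Qed.

(** Distinct eigenspaces of the symmetric matrix [M] are orthogonal, and by
completeness a vector orthogonal to all of them but the last lies in the last. *)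
Lemma averages_all_but_lastP (R : realType) (m : nat) (s : seq R)
    (W : {set 'I_m.+3}) (a : 'I_m.+3 -> R) :
  let M := norm_adjacency R 2 (@cycle_graph m.+3) in
  frequency_order M s ->
  averages_all_but_last M s W a <->
  deviation R _ W a *m M = last 1 s *: deviation R _ W a.
Proof.
move=> M [us mem_s _ _]; split=> [avg|ed i lti].
  apply: orthogonal_others_eigen => k kl phi ephi.
  have ks : ccos R m k 1 \in s by rewrite mem_s eigenvalue_ccos.
  have lts : (index (ccos R m k 1%R) s < size s)%N by rewrite index_mem.
  apply: (proj1 (averagesP _ _ _ _ _) (avg (index (ccos R m k 1) s) _)).
    rewrite ltn_neqAle -ltnS (ltn_predK lts) lts andbT.
    apply: contraNneq kl => e.
    by rewrite -nth_last -e nth_index.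
  by apply/eigenspaceP; rewrite nth_index.
apply/averagesP => phi /eigenspaceP ephi.
apply: eigenspace_orthogonal ed ephi _; first exact: cycle_sym.
have lts : (i < size s)%N by apply: leq_trans lti (leq_pred _).
rewrite -nth_last (set_nth_default 0) ?(ltn_predK lts) //.
by rewrite nth_uniq ?(ltn_predK lts) // gtn_eqF.
Qed.

Theorem theorem4p9 (R : realType) (n : nat) (s : seq R) :
  (3 <= n)%N ->
  frequency_order (norm_adjacency R 2 (@cycle_graph n)) s ->
  exists W : {set 'I_n},
    positively_weighted_extremal_design
      (norm_adjacency R 2 (@cycle_graph n)) s W /\
    (forall W' : {set 'I_n},
       weighted_extremal_design (norm_adjacency R 2 (@cycle_graph n)) s W' ->
       (#|W| <= #|W'|)%N).
Proof.
case: n => [|[|[|m]]] // _ fo.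
have lt1 := last_eigenvalue_lt1 _ _ _ fo.
have [k ek] : exists k, last 1 s = ccos R m k 1.
  apply: eigenvalue_cycle; have [_ mem_s hd _] := fo.
  by rewrite -mem_s; case: (s) hd => // x s' _ /=; apply: (mem_last x s').
rewrite ek in lt1.
have n0 : m.+3%:R != 0 :> R by rewrite pnatr_eq0.
have [t [f_ge0 f_zeros]] := tight_chord _ _ _ lt1.
pose f w := 1 - ccos R m k w - t * csin R m k w.
exists (~: [set w | f w == 0]); split.
  exists (fun w => f w / m.+3%:R); split=> [w|].
    rewrite !inE => fw; apply: divr_gt0; rewrite ?ltr0n //.
    by rewrite lt_neqAle eq_sym fw f_ge0.
  apply/averages_all_but_lastP => //; rewrite ek.
  apply: (@wave_eigen _ _ _ (- m.+3%:R^-1) (- t / m.+3%:R)) => w.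
  rewrite mxE !inE.
  have -> : (if f w != 0 then f w / m.+3%:R else 0) = f w / m.+3%:R.
    by case: eqP => [->|] //=; rewrite mul0r.
  by rewrite /f; move: (m.+3%:R) n0 => N n0; field.
move=> W' [a /(averages_all_but_lastP _ _ _ _ _ fo)]; rewrite ek => ed.
have [A [B dE]] := eigen_wave _ _ _ _ lt1 ed.
rewrite -(leq_add2l #|[set w | f w == 0]|) cardsC.
rewrite -(cardsC W') addnC leq_add2r; apply: leq_trans f_zeros.
apply: leq_trans (card_zeros_le _ _ _ (A * m.+3%:R) (B * m.+3%:R)).
apply/subset_leq_card/subsetP => w; rewrite !inE => /negPf wW'.
have := dE w; rewrite mxE wW' sub0r => e.
have -> : A * m.+3%:R * ccos R m k w + B * m.+3%:R * csin R m k w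
  = m.+3%:R * (A * ccos R m k w + B * csin R m k w) by ring.
by rewrite -e mulrN divff // subrr.
Qed.
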